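(* The category $\mathbf{SD}$ of all strong $d$-spaces with continuous mappings is not reflective in the category $\mathbf{Top_0}$ of all $T_0$ spaces with continuous mappings.
   Context: The specialization order of a $T_0$ space $X$ is $x\le y$ iff $x\in\mathrm{cl}(\{y\})$; $\uparrow x=\{y\in X: x\le y\}$. A $T_0$ space $X$ is a strong $d$-space if for any $x\in X$, any directed (with respect to the specialization order) subset $D$ of $X$ and any open subset $U$ of $X$, $\bigcap_{d\in D}\uparrow d\cap\uparrow x\subseteq U$ implies $\uparrow d_0\cap\uparrow x\subseteq U$ for some $d_0\in D$. (Directed sets are nonempty.) A full subcategory $\mathbf{K}$ of $\mathbf{Top_0}$ is reflective if for each $X\in\mathbf{Top_0}$ there are $X^k\in\mathbf{K}$ and a continuous mapping $\mu_X:X\to X^k$ such that for every continuous mapping $f:X\to Z$ with $Z\in\mathbf{K}$ there is a unique continuous mapping $g:X^k\to Z$ with $g\circ\mu_X=f$. *)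

(* Defs.v *)
From mathcomp Require Import all_boot all_order all_algebra.
From mathcomp Require Import all_classical all_reals topology separation_axioms.

Set Implicit Arguments.
Unset Strict Implicit.
Unset Printing Implicit Defensive.

Local Open Scope classical_set_scope.

Section StrongDSpace.
Variable X : topologicalType.

Definition spec_le (x y : X) : Prop := closure [set y] x.

Definition spec_up (x : X) : set X := [set y | spec_le x y].

Definition spec_directed (D : set X) : Prop :=
  D !=set0 /\
  forall a b, D a -> D b -> exists c, [/\ D c, spec_le a c & spec_le b c].

End StrongDSpace.

Definition strong_d_space (X : topologicalType) : Prop :=
  kolmogorov_space X /\
  forall (x : X) (D U : set X), spec_directed D -> open U ->
    (\bigcap_(d in D) spec_up d) `&` spec_up x `<=` U ->
    exists d0, D d0 /\ spec_up d0 `&` spec_up x `<=` U.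

(* A full subcategory of the T0 spaces is given by its class of objects K.
   [topologicalType] spaces need not be pointed, so the empty space is
   included; the choice structure they carry exists on every type. *)
Definition reflective_in_Top0 (K : topologicalType -> Prop) : Prop :=
  forall X : topologicalType, kolmogorov_space X ->
  exists (Xk : topologicalType) (mu : X -> Xk),
    [/\ K Xk, continuous mu &
        forall (Z : topologicalType) (f : X -> Z), K Z -> continuous f ->
        exists! g : Xk -> Z, continuous g /\ g \o mu = f].

(* Main.v *)
Require Import Defs.
From HB Require Import structures.
From mathcomp Require Import all_boot all_order all_algebra.
From mathcomp Require Import all_classical all_reals topology separation_axioms.

(* Strong d-spaces are closed under retracts, and the reflection of a product of
   two strong d-spaces retracts onto the product, so reflectivity would make
   products of strong d-spaces strong d-spaces. They are not: let [fork] be the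
   discrete space N with two incomparable lower bounds a and b adjoined, and let
   [chain] be the Scott space omega + 1. In [fork * chain], the open set
   U = {(n, m) | n in N, n <= m} contains the intersection N x {omega} of the
   sets ↑(a, k) ∩ ↑(b, 0) = N x ↑k, but it contains none of these sets. *)

Set Implicit Arguments.
Unset Strict Implicit.
Unset Printing Implicit Defensive.

Local Open Scope classical_set_scope.

(** * The specialization order and the T0 axiom *)

Lemma spec_leP (X : topologicalType) (x y : X) :
  spec_le x y <-> forall U, open U -> U x -> U y.
Proof.
split=> [xy U oU Ux|h B].
  by have [_ [-> ]] := xy U (open_nbhs_nbhs (conj oU Ux)).
rewrite nbhsE => -[U [oU Ux] UB]; exists y; split=> //.
by apply: UB; exact: h oU Ux.
Qed.

Lemma spec_le_refl (X : topologicalType) (x : X) : spec_le x x.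
Proof. exact/spec_leP. Qed.

Lemma spec_le_continuous (X Y : topologicalType) (f : X -> Y) (x y : X) :
  continuous f -> spec_le x y -> spec_le (f x) (f y).
Proof.
move=> /continuousP cf /spec_leP xy; apply/spec_leP => U /cf.
exact: xy.
Qed.

Lemma spec_directed_image (X Y : topologicalType) (f : X -> Y) (D : set X) :
  continuous f -> spec_directed D -> spec_directed (f @` D).
Proof.
move=> cf [[d Dd] dirD]; split; first by exists (f d), d.
move=> _ _ [a Da <-] [b Db <-]; have [c [Dc ac bc]] := dirD a b Da Db.
by exists (f c); split; [exists c| exact: spec_le_continuous..].
Qed.

Lemma kolmogorov_openP (X : topologicalType) :
  kolmogorov_space X <-> forall x y : X, spec_le x y -> spec_le y x -> x = y.
Proof.
split=> [T0 x y xy yx|anti x y xNy].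
  apply: contrapT => /eqP /T0 [A].
  rewrite !inE => -[] [nA]; apply.
    by have [_ [-> ]] := xy A nA.
  by have [_ [-> ]] := yx A nA.
apply: contrapT => noA; move/eqP: xNy; apply; apply: anti; apply/spec_leP => U oU.
  move=> Ux; apply: contrapT => NUy; apply: noA; exists U; left.
  by rewrite !inE; split=> //; exact: open_nbhs_nbhs.
move=> Uy; apply: contrapT => NUx; apply: noA; exists U; right.
by rewrite !inE; split=> //; exact: open_nbhs_nbhs.
Qed.

(** * Products, retracts and reflections *)

Lemma kolmogorov_prod (X Y : topologicalType) :
  kolmogorov_space X -> kolmogorov_space Y -> kolmogorov_space (X * Y)%type.
Proof.
move=> /kolmogorov_openP TX /kolmogorov_openP TY; apply/kolmogorov_openP.
have cfst : continuous (@fst X Y) by move=> p; exact: cvg_fst.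
have csnd : continuous (@snd X Y) by move=> p; exact: cvg_snd.
move=> [x1 y1] [x2 y2] h k; congr pair.
  by apply: TX; [exact: spec_le_continuous cfst h|exact: spec_le_continuous cfst k].
by apply: TY; [exact: spec_le_continuous csnd h|exact: spec_le_continuous csnd k].
Qed.

(** Transport [x] and [D] to [Y] along [s], and pull [U] back along [r]. Continuous maps are
    monotone and [r] undoes [s], so [r] sends upper bounds of the transported data to upper bounds
    of the original data. *)
Lemma strong_d_space_retract (X Y : topologicalType) (s : X -> Y) (r : Y -> X) :
  continuous s -> continuous r -> cancel s r -> kolmogorov_space X ->
  strong_d_space Y -> strong_d_space X.
Proof.
move=> cs cr srK T0 [_ sdY]; split=> // x D U dirD oU capU.
have := sdY (s x) (s @` D) (r @^-1` U) (spec_directed_image cs dirD).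
case; first by move/continuousP: cr; exact.
  move=> z [Dz xz]; apply: capU; split.
    move=> d Dd; rewrite /spec_up /= -(srK d); apply: spec_le_continuous cr _.
    by apply: Dz; exists d.
  by rewrite /spec_up /= -(srK x); exact: spec_le_continuous cr xz.
move=> _ [[d Dd <-] dU]; exists d; split=> // y [dy xy].
rewrite -(srK y); apply: dU.
by split; apply: spec_le_continuous.
Qed.

(** Both projections factor through [mu], and pairing the two factors gives a continuous left
    inverse of [mu]. *)
Lemma reflective_prod (X Y : topologicalType) :
  reflective_in_Top0 strong_d_space -> strong_d_space X -> strong_d_space Y ->
  strong_d_space (X * Y)%type.
Proof.
move=> refl sdX sdY.
have T0 := kolmogorov_prod sdX.1 sdY.1.
have [Z [mu [sdZ cmu up]]] := refl (X * Y)%type T0.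
have [p [[cp pE] _]] := up X fst sdX (fun _ => cvg_fst).
have [q [[cq qE] _]] := up Y snd sdY (fun _ => cvg_snd).
apply: (@strong_d_space_retract _ _ mu (fun z => (p z, q z))) => //.
  by move=> z; apply: cvg_pair; [exact: cp|exact: cq].
move=> w; rewrite [RHS]surjective_pairing.
by rewrite -[p _]/((p \o mu) w) -[q _]/((q \o mu) w) pE qE.
Qed.

(** * The two factors *)

(* A greatest element of D absorbs the intersection, so the strong d-space
   condition only concerns directed sets without one. *)
Lemma strong_d_max (X : topologicalType) (x m : X) (D U : set X) :
  D m -> (forall d, D d -> spec_le d m) ->
  (\bigcap_(d in D) spec_up d) `&` spec_up x `<=` U ->
  exists d0, D d0 /\ spec_up d0 `&` spec_up x `<=` U.
Proof.
move=> Dm maxm capU; exists m; split=> // y [my xy]; apply: capU; split=> // d Dd.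
apply/spec_leP => V oV Vd; apply: (spec_leP m y).1 => //.
by apply: (spec_leP d m).1 => //; exact: maxm.
Qed.

Definition fork : Type := (bool + nat)%type.
HB.instance Definition _ := Choice.on fork.

(** The Alexandrov topology: the open sets are the upper sets of the order in which both [inl b] lie
    below every [inr n]. *)
Definition fork_open (U : set fork) : Prop :=
  forall b n, U (inl b) -> U (inr n).

Lemma fork_openT : fork_open setT. Proof. by []. Qed.

Lemma fork_openI : setI_closed fork_open.
Proof. by move=> A B oA oB b n [/oA ? /oB ?]; split. Qed.

Lemma fork_open_bigU (I : Type) (f : I -> set fork) :
  (forall i, fork_open (f i)) -> fork_open (\bigcup_i f i).
Proof. by move=> of_ b n [i _ /of_ fi]; exists i => //; exact: fi. Qed.

HB.instance Definition _ :=
  isOpenTopological.Build fork fork_openT fork_openI fork_open_bigU.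

Lemma fork_leE (x y : fork) :
  spec_le x y <-> x = y \/ exists b n, x = inl b /\ y = inr n.
Proof.
split=> [/spec_leP xy|].
  case: x xy => [b|n] xy.
    suff : [set z : fork | z = inl b \/ exists n, z = inr n] y.
      by case=> [->|[n ->]]; [left|right; exists b, n].
    by apply: xy; [move=> c n _; right; exists n|left].
  suff : [set inr n : fork] y by move=> ->; left.
  by apply: xy => // b k.
case=> [->|[b [n [-> ->]]]]; first exact: spec_le_refl.
by apply/spec_leP => U /(_ b n).
Qed.

(** Every directed set has a greatest element: an [inr n] in [D] is maximal in [fork], hence the
    greatest element of [D]; otherwise [D] is a single [inl b], because distinct [inl] points have
    only [inr] upper bounds. *)
Lemma strong_d_fork : strong_d_space fork.
Proof.
split.
  apply/kolmogorov_openP => x y /fork_leE[//|[b [n [-> ->]]]].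
  by move=> /fork_leE[|[? [? []]]].
move=> x D U [[d Dd] dirD] _.
have [[n Dn]|noN] := pselect (exists n, D (inr n)).
  apply: (strong_d_max Dn) => e De; have [c [_ ec]] := dirD _ _ De Dn.
  by move=> /fork_leE[->//|[? [? []]]].
apply: (strong_d_max Dd) => e De; have [c [Dc ec dc]] := dirD _ _ De Dd.
case: c Dc ec dc => [c Dc|n Dn]; last by case: noN; exists n.
move=> ec /fork_leE[->//|[? [? []]]//].
Qed.

(* [Some n] is the number n and [None] is omega. *)
Definition chain : Type := option nat.
HB.instance Definition _ := Choice.on chain.

(** The Scott topology. Read from left to right, the equivalence is inaccessibility of omega by
    suprema; from right to left, it is upward closure at omega. *)
Definition chain_open (U : set chain) : Prop :=
  (forall m n, (m <= n)%N -> U (Some m) -> U (Some n)) /\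
  (U None <-> exists n, U (Some n)).

Lemma chain_openT : chain_open setT.
Proof. by split=> //; split=> // _; exists 0%N. Qed.

Lemma chain_openI : setI_closed chain_open.
Proof.
move=> A B [upA infA] [upB infB]; split=> [m n mn [Am Bm]|].
  by split; [exact: upA Am|exact: upB Bm].
split=> [[/infA [m Am] /infB [n Bn]]|[n [An Bn]]].
  exists (maxn m n); split.
    exact: upA (leq_maxl _ _) Am.
  exact: upB (leq_maxr _ _) Bn.
by split; [apply/infA; exists n|apply/infB; exists n].
Qed.

Lemma chain_open_bigU (I : Type) (f : I -> set chain) :
  (forall i, chain_open (f i)) -> chain_open (\bigcup_i f i).
Proof.
move=> of_; split=> [m n mn [i _ fm]|].
  by exists i => //; exact: (of_ i).1 mn fm.
split=> [[i _ /(of_ i).2 [n fn]]|[n [i _ fn]]]; first by exists n, i.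
by exists i => //; apply/(of_ i).2; exists n.
Qed.

HB.instance Definition _ :=
  isOpenTopological.Build chain chain_openT chain_openI chain_open_bigU.

Lemma chain_le_Some (m : nat) (y : chain) :
  spec_le (Some m : chain) y <-> forall n, y = Some n -> (m <= n)%N.
Proof.
split=> [/spec_leP my n yE|my].
  (* Test the order on the Scott-open set of all points from [m] up to omega. *)
  have : [set z : chain | if z is Some k then (m <= k)%N : Prop else True] y.
    apply: my => //=; split=> [k l kl mk|]; first exact: leq_trans mk kl.
    by split=> [_|//]; exists m => /=.
  by rewrite yE.
apply/spec_leP => U [upU infU] Um; case: y my => [n|_]; last by apply/infU; exists m.
by move=> /(_ n erefl) mn; exact: upU mn Um.
Qed.

Lemma chain_le_None (x : chain) : spec_le x None.
Proof.
by case: x => [m|]; [apply/chain_le_Some|exact: spec_le_refl].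
Qed.

Lemma chain_None_le (y : chain) : spec_le (None : chain) y -> y = None.
Proof.
move=> /spec_leP Ny; case: y Ny => [n|//] Ny.
suff : [set z : chain | if z is Some k then (n < k)%N : Prop else True] (Some n).
  by rewrite /= ltnn.
apply: Ny => //; split=> [k l kl nk|]; first exact: leq_trans nk kl.
by split=> // _; exists n.+1 => /=.
Qed.

Lemma strong_d_chain : strong_d_space chain.
Proof.
split.
  apply/kolmogorov_openP => -[m|] [n|] //; last first.
  - by move/chain_None_le.
  - by move=> _ /chain_None_le.
  move=> /chain_le_Some/(_ n erefl) mn /chain_le_Some/(_ m erefl) nm.
  by congr Some; apply/eqP; rewrite eqn_leq mn.
move=> x D U [[d Dd] dirD] oU capU.
(* Omega lies above every point, so it belongs to the intersection. *)
have UN : U None.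
  by apply: capU; split=> [e _|]; exact: chain_le_None.
have [n Un] := oU.2.1 UN.
(* Either [D] reaches [n] at some [e], whose upper set then lies in [U], or [D] consists of numbers
   below [n] and has a maximum. *)
have [[e [De ne]]|bounded] := pselect (exists e, D e /\ spec_le (Some n : chain) e).
  exists e; split=> // y [ey _].
  have Ue := (spec_leP _ e).1 ne U oU Un.
  exact: (spec_leP e y).1 ey U oU Ue.
have Dlt e : D e -> exists2 m, e = Some m & (m < n)%N.
  case: e => [m|] De; last by case: bounded; exists None; split=> //; exact: chain_le_None.
  exists m => //; rewrite ltnNge; apply/negP => nm.
  by case: bounded; exists (Some m); split=> //; apply/chain_le_Some => ? [<-].
have exP : exists m, `[< D (Some m) >].
  by have [m dE _] := Dlt d Dd; exists m; apply/asboolP; rewrite -dE.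
have ubP m : `[< D (Some m) >] -> (m <= n)%N.
  by move=> /asboolP /Dlt [_ [<-]] /ltnW.
have [m /asboolP Dm maxm] := ex_maxnP exP ubP.
apply: (strong_d_max Dm) capU => e De; have [k eE _] := Dlt e De.
rewrite eE; apply/chain_le_Some => _ [<-]; apply: maxm.
by apply/asboolP; rewrite -eE.
Qed.

(** * The product of the two factors *)

Lemma spec_le_prod (X Y : topologicalType) (p q : X * Y) :
  spec_le p.1 q.1 -> spec_le p.2 q.2 -> spec_le p q.
Proof.
move=> h1 h2 B [[P Q] /= [nP nQ] PQ]; exists q; split=> //; apply: PQ.
by have [_ [-> Pq]] := h1 P nP; have [_ [-> Qq]] := h2 Q nQ.
Qed.

Lemma not_strong_d_prod : ~ strong_d_space (fork * chain)%type.
Proof.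
move=> [_ sd].
have cfst : continuous (@fst fork chain) by move=> p; exact: cvg_fst.
have csnd : continuous (@snd fork chain) by move=> p; exact: cvg_snd.
pose D := [set p : fork * chain | exists k, p = (inl true, Some k)].
pose U := [set p : fork * chain |
  exists2 n, p.1 = inr n & spec_le (Some n : chain) p.2].
have [] := sd (inl false, Some 0%N) D U.
- split; first by exists (inl true, Some 0%N), 0%N.
  move=> _ _ [k ->] [l ->]; exists (inl true, Some (maxn k l)).
  split; first by exists (maxn k l).
    by apply: spec_le_prod; [exact: spec_le_refl|];
      apply/chain_le_Some => _ [<-]; exact: leq_maxl.
  by apply: spec_le_prod; [exact: spec_le_refl|];
      apply/chain_le_Some => _ [<-]; exact: leq_maxr.
- rewrite openE => -[x y] [n /= -> ny].
  (* The rectangle of the isolated point [inr n] and the open upper set of [n] is a neighbourhood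
     inside [U]. *)
  exists ([set inr n : fork], [set z | spec_le (Some n : chain) z]) => /=.
    split; first by apply: open_nbhs_nbhs; split=> // b k.
    apply: open_nbhs_nbhs; split=> //; split.
      move=> k l kl /chain_le_Some/(_ k erefl) nk; apply/chain_le_Some => _ [<-].
      exact: leq_trans kl.
    split=> _; last exact: chain_le_None.
    by exists n; exact: spec_le_refl.
  by move=> [u z] [/= -> nz]; exists n.
- move=> [x y] [capD xb].
  have xa : spec_le (inl true : fork) x.
    by apply: (spec_le_continuous cfst (capD (inl true, Some 0%N) _)); exists 0%N.
  have xb' : spec_le (inl false : fork) x by exact: (spec_le_continuous cfst xb).
  have yk k : spec_le (Some k : chain) y.
    by apply: (spec_le_continuous csnd (capD (inl true, Some k) _)); exists k.
  (* The two [inl] points are incomparable, so a common upper bound is some [inr n]. *)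
  have [n xE] : exists n, x = inr n.
    move/fork_leE: xa xb' => [<-|[_ [n [_ ->]]]]; last by exists n.
    by move=> /fork_leE[//|[? [? []]]].
  by exists n.
move=> _ [[k ->] kU].
(* This point is above both [(inl true, Some k)] and [(inl false, Some 0)], but membership in [U]
   would force [k.+1 <= k]. *)
have [|n /= [<-] /chain_le_Some/(_ k erefl)] := kU (inr k.+1, Some k).
  by split; apply: spec_le_prod => /=;
    [apply/fork_leE; right; exists true, k.+1|exact: spec_le_refl|
     apply/fork_leE; right; exists false, k.+1|apply/chain_le_Some].
by rewrite ltnn.
Qed.

Theorem corollary3p5 : ~ reflective_in_Top0 strong_d_space.
Proof.
move=> refl; apply: not_strong_d_prod.
exact: reflective_prod refl strong_d_fork strong_d_chain.
Qed.
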